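(* Let $A\in\mathbb{R}^{n\times n}$ and $B\in\mathbb{R}^{n\times m}$ with $(A,B)$ controllable, let $Q\in\mathbb{R}^{n\times n}$ and $R\in\mathbb{R}^{m\times m}$ be symmetric positive definite, and let $J$ be the associated continuous-time LQR cost on $\mathcal{G}=\{K\in\mathbb{R}^{m\times n} : A-BK \text{ is Hurwitz}\}$. Let $$\partial\mathcal{G}=\{K\in\mathbb{R}^{m\times n} : \max_i\operatorname{Re}(\lambda_i(A-BK))=0\},$$ where $\lambda_i(\cdot)$ denotes the eigenvalues. For any $\overline K\in\partial\mathcal{G}$ and any sequence $\{K_i\}_{i=1,2,\dots}$ of matrices $K_i\in\mathcal{G}$ with $\lim_{i\to\infty}K_i=\overline K$, $$\lim_{i\to\infty}\|\nabla J(K_i)\|_F=\infty.$$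
   Context: For $K\in\mathcal{G}$ let $P_K$ be the unique solution of the Lyapunov equation $$P_K(A-BK)+(A-BK)^\top P_K+K^\top RK+Q=0,$$ and define $J(K)=\operatorname{trace}(P_K)$. The gradient of $J$ (with respect to the Frobenius inner product) is $\nabla J(K)=-2(B^\top P_K-RK)Y_K$, where $Y_K$ is the unique positive definite solution of $Y_K(A-BK)^\top+(A-BK)Y_K+I=0$. $\|\cdot\|_F$ is the Frobenius norm. *)

(* Defs.v *)
From HB Require Import structures.
From mathcomp Require Import all_boot all_order all_algebra.
From mathcomp Require Import complex.
From mathcomp Require Import all_classical all_reals all_analysis.

Set Implicit Arguments.
Unset Strict Implicit.
Unset Printing Implicit Defensive.

Import Order.TTheory GRing.Theory Num.Theory.
Import numFieldNormedType.Exports.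

Local Open Scope classical_set_scope.
Local Open Scope ring_scope.

Section LinearSystems.
Variable R : realType.

Definition posdefmx (n : nat) (S : 'M[R]_n) : Prop :=
  S^T = S /\ forall x : 'cV[R]_n, x != 0 -> 0 < (x^T *m S *m x) 0 0.

(* Kalman's criterion: [B, A B, ..., A^(n-1) B] has rank n. *)
Definition controllable (n m : nat) (A : 'M[R]_n) (B : 'M[R]_(n, m)) : Prop :=
  \rank (\mxrow_(j < n) (A ^+ j *m B)) = n.

Definition re_spectrum (n : nat) (M : 'M[R]_n) : set R :=
  [set complex.Re z | z in [set z : R[i] | eigenvalue (map_mx (real_complex R) M) z]].

Definition Hurwitz (n : nat) (M : 'M[R]_n) : Prop :=
  forall r, re_spectrum M r -> r < 0.

Definition frobenius (m n : nat) (M : 'M[R]_(m, n)) : R :=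
  Num.sqrt (\sum_i \sum_j M i j ^+ 2).

(* The representative of the Fréchet differential of f at K for the Frobenius
   inner product tr(G^T H): its (i, j) entry is the value of the differential
   on the elementary matrix E_ij.  When f is not differentiable at K, ['d f K]
   is a default value. *)
Definition gradient (m n : nat) (f : 'M[R]_(m, n) -> R) (K : 'M[R]_(m, n)) :
    'M[R]_(m, n) :=
  \matrix_(i, j) ('d f K (delta_mx i j)).

End LinearSystems.

Section LQR.
Variables (R : realType) (n m : nat).
Variables (A : 'M[R]_n) (B : 'M[R]_(n, m)) (Q : 'M[R]_n) (S : 'M[R]_m).

Definition stabilizing : set 'M[R]_(m, n) :=
  [set K | Hurwitz (A - B *m K)].

(* The maximum of a set is its element that is also an upper bound; here that
   element is 0. *)
Definition stabilizing_boundary : set 'M[R]_(m, n) :=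
  [set K | re_spectrum (A - B *m K) 0 /\ ubound (re_spectrum (A - B *m K)) 0].

Definition lyapunov_solution (K : 'M[R]_(m, n)) : set 'M[R]_n :=
  [set P | P *m (A - B *m K) + (A - B *m K)^T *m P + K^T *m S *m K + Q = 0].

(* The Lyapunov equation has exactly one solution for K in [stabilizing].
   Outside this set, which is open, the value is irrelevant: it does not
   affect the gradient of [lqr_cost] at stabilizing gains. *)
Definition lyapunov (K : 'M[R]_(m, n)) : 'M[R]_n := xget 0 (lyapunov_solution K).

Definition lqr_cost (K : 'M[R]_(m, n)) : R := \tr (lyapunov K).

End LQR.

(* Main.v *)
Require Import Defs.
From HB Require Import structures.
From mathcomp Require Import all_boot all_order all_algebra.
From mathcomp Require Import complex.
From mathcomp Require Import all_classical all_reals all_analysis.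
From mathcomp Require Import ring lra.

Set Implicit Arguments.
Unset Strict Implicit.
Unset Printing Implicit Defensive.

Import Order.TTheory GRing.Theory Num.Theory.
Import numFieldNormedType.Exports.

Local Open Scope classical_set_scope.
Local Open Scope ring_scope.

(** Let P be the Lyapunov solution at a stabilizing gain K, Y the Gramian, that
    is, the solution of Y F^T + F Y = - I for F = A - B K, and E = S K - B^T P,
    so that the gradient is 2 E Y.  As K tends to the boundary, P, then E, then
    E Y must blow up, each for an elementary reason.

    - P blows up because A - B Kbar has a purely imaginary eigenvalue: testing
      the Lyapunov equation on its eigenvector, everything that involves P
      cancels up to a multiple of |K - Kbar| |P|, whereas the constant term is
      bounded away from 0.  Hence c <= |K - Kbar| |P| with c > 0
      ([lyapop_blowup]).
    - E blows up with P.  Rewrite the Lyapunov equation of K with the operator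
      of one fixed stabilizing gain K0, such as the first term of the
      sequence.  All terms but those in E are bounded ([lyapop_other_gain]), and
      the operator of K0 is a fixed invertible linear map, so
      |P| <= C (1 + |E|).
    - E Y blows up with E, since |E|_F ^ 2 = - 2 tr (E Y F^T E^T) gives
      |E| <= C |F| |E Y| ([mx_norm_le_mul_gramian]).

    The spectral fact behind all this is the invertibility of the operators
    X |-> X F + F^T X for F Hurwitz ([lyapop_eq0]), a case of Sylvester's
    theorem.  The formula for the gradient comes from a Taylor expansion with
    quadratic remainder ([lqr_cost_taylor]). *)

(** * Sylvester equations *)

Lemma eigenvalue_unitmx (F : fieldType) (n : nat) (M : 'M[F]_n) (a : F) :
  eigenvalue M a = (M - a%:M \notin unitmx).
Proof. by rewrite /eigenvalue /eigenspace kermx_eq0 row_free_unit. Qed.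

Lemma eigenvalue_trmx (F : fieldType) (n : nat) (M : 'M[F]_n) (a : F) :
  eigenvalue M^T a = eigenvalue M a.
Proof.
by rewrite !eigenvalue_unitmx -[in RHS]unitmx_tr linearB /= tr_scalar_mx.
Qed.

Lemma eigenvalue_oppmx (F : fieldType) (n : nat) (M : 'M[F]_n) (a : F) :
  eigenvalue (- M) a = eigenvalue M (- a).
Proof.
by apply/eigenvalueP/eigenvalueP => -[v vM v0]; exists v => //;
  [rewrite scaleNr -vM mulmxN opprK | rewrite mulmxN vM scaleNr opprK].
Qed.

(** From X M = N X one gets X p(M) = p(N) X for every polynomial p.  For p the
    characteristic polynomial of M the left side vanishes by Cayley-Hamilton,
    while p(N) is a product of factors N - a, with a in the spectrum of M, all
    of them invertible. *)
Lemma sylvester_eq0 (F : closedFieldType) (m n : nat) (M : 'M[F]_n)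
    (N : 'M[F]_m) (X : 'M[F]_(m, n)) :
  (forall a, eigenvalue M a -> ~~ eigenvalue N a) ->
  X *m M = N *m X -> X = 0.
Proof.
case: n M X => [|n] M X MN; first by move=> _; apply: thinmx0.
have [rs Mrs] := closed_field_poly_normal (char_poly M).
rewrite (monicP (char_poly_monic M)) scale1r in Mrs.
have rsN a : a \in rs -> N - a%:M \in unitmx.
  move=> ars; rewrite -[_ \in _]negbK -eigenvalue_unitmx MN //.
  by rewrite eigenvalue_root_char Mrs root_prod_XsubC.
have: X *m horner_mx M (char_poly M) = 0 by rewrite Cayley_Hamilton mulmx0.
rewrite Mrs rmorph_prod /=; elim: rs X rsN {Mrs} => [|a rs IH] X rsN.
  by rewrite big_nil mulmx1.
rewrite big_cons mulmxA rmorphB /= horner_mx_X horner_mx_C => X0 XM.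
have XMa : X *m (M - a%:M) = (N - a%:M) *m X.
  by rewrite mulmxBr mulmxBl XM scalar_mxC.
have Xa0 : (N - a%:M) *m X = 0.
  apply: IH.
  - by move=> b brs; apply: rsN; rewrite in_cons brs orbT.
  - by rewrite -XMa.
  - by rewrite -mulmxA XM !mulmxA mulmxBl mulmxBr scalar_mxC.
by rewrite -[X](mulKmx (rsN a (mem_head _ _))) Xa0 mulmx0.
Qed.

(** * Lyapunov operators *)

Definition lyapop (R : realType) (n : nat) (F X : 'M[R]_n) : 'M[R]_n :=
  X *m F + F^T *m X.

Lemma lyapop_is_linear (R : realType) (n : nat) (F : 'M[R]_n) :
  linear (lyapop F).
Proof.
move=> a X Y; rewrite /lyapop mulmxDl mulmxDr scalerDr -scalemxAl -scalemxAr.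
by rewrite addrACA.
Qed.

HB.instance Definition _ (R : realType) (n : nat) (F : 'M[R]_n) :=
  GRing.isLinear.Build R 'M[R]_n 'M[R]_n *:%R (lyapop F) (lyapop_is_linear F).

(** The equation reads X F = (- F^T) X.  The spectrum of F is in the open left
    half-plane and that of - F^T in the open right one, so they are disjoint. *)
Lemma lyapop_eq0 (R : realType) (n : nat) (F X : 'M[R]_n) :
  Hurwitz F -> lyapop F X = 0 -> X = 0.
Proof.
move=> HF /eqP; rewrite addr_eq0 -mulNmx => /eqP XF.
apply: (@map_mx_inj _ _ (real_complex R)); rewrite map_mx0.
apply: (@sylvester_eq0 _ _ _ (map_mx (real_complex R) F)
                             (map_mx (real_complex R) (- F^T))); last first.
  by rewrite -!map_mxM XF.
move=> a Fa; apply/negP.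
rewrite map_mxN -map_trmx eigenvalue_oppmx eigenvalue_trmx => FNa.
have a0 : complex.Re a < 0 by exact: HF (ex_intro2 _ _ a Fa erefl).
have : complex.Re (- a) < 0 by exact: HF (ex_intro2 _ _ (- a) FNa erefl).
by case: a {Fa FNa} a0 => x y /=; lra.
Qed.

Lemma Hurwitz_trmx (R : realType) (n : nat) (F : 'M[R]_n) :
  Hurwitz F -> Hurwitz F^T.
Proof.
move=> HF r [z zF <-]; apply: HF; apply: (ex_intro2 _ _ z _ erefl).
by move: zF; rewrite /= -map_trmx eigenvalue_trmx.
Qed.

Lemma lyapop_trmx (R : realType) (n : nat) (F X : 'M[R]_n) :
  lyapop F X^T = (lyapop F X)^T.
Proof. by rewrite /lyapop linearD /= !trmx_mul trmxK addrC. Qed.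

(** * Estimates in the max norm *)

Lemma mx_entry_le_norm (R : realType) (m n : nat) (M : 'M[R]_(m, n)) i j :
  `|M i j| <= `|M|.
Proof.
rewrite [leRHS]/Num.norm /= mx_normrE.
by rewrite (le_bigmax_cond _ (fun ij : 'I_m * 'I_n => `|M ij.1 ij.2|) (j := (i, j))).
Qed.

Lemma mx_norm_le (R : realType) (m n : nat) (M : 'M[R]_(m, n)) (c : R) :
  0 <= c -> (forall i j, `|M i j| <= c) -> `|M| <= c.
Proof.
by move=> c0 Mc; rewrite [leLHS]/Num.norm /= mx_normrE bigmax_le // => -[i j] _.
Qed.

Lemma mx_norm_mul (R : realType) (m n p : nat) (M : 'M[R]_(m, n))
    (N : 'M[R]_(n, p)) : `|M *m N| <= n%:R * (`|M| * `|N|).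
Proof.
apply: mx_norm_le => [|i j]; first by rewrite !mulr_ge0.
rewrite mxE (le_trans (ler_norm_sum _ _ _)) //.
rewrite (@le_trans _ _ (\sum_(k < n) `|M| * `|N|)) //.
  by apply: ler_sum => k _; rewrite normrM ler_pM // mx_entry_le_norm.
by rewrite sumr_const card_ord mulr_natl.
Qed.

Lemma mx_norm_mul_le (R : realType) (m n p : nat) (M : 'M[R]_(m, n))
    (N : 'M[R]_(n, p)) (a b : R) : `|M| <= a -> `|N| <= b ->
  `|M *m N| <= n%:R * (a * b).
Proof.
by move=> Ma Nb; rewrite (le_trans (mx_norm_mul _ _)) // ler_wpM2l // ler_pM.
Qed.

Lemma mx_norm_trmx (R : realType) (m n : nat) (M : 'M[R]_(m, n)) :
  `|M^T| = `|M|.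
Proof.
have trmx_le p q (N : 'M[R]_(p, q)) : `|N^T| <= `|N|.
  by apply: mx_norm_le => // i j; rewrite mxE mx_entry_le_norm.
by apply/eqP; rewrite eq_le trmx_le -{1}[M]trmxK trmx_le.
Qed.

Lemma mx_norm_trace (R : realType) (n : nat) (M : 'M[R]_n) :
  `|\tr M| <= n%:R * `|M|.
Proof.
rewrite (le_trans (ler_norm_sum _ _ _)) //.
rewrite (@le_trans _ _ (\sum_(k < n) `|M|)) //.
  by apply: ler_sum => k _; rewrite mx_entry_le_norm.
by rewrite sumr_const card_ord mulr_natl.
Qed.

Lemma mxvec_norm (R : realType) (m n : nat) (M : 'M[R]_(m, n)) :
  `|mxvec M| = `|M|.
Proof.
apply/eqP; rewrite eq_le; apply/andP; split; apply: mx_norm_le => // i j.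
  by case/mxvec_indexP: j => k l; rewrite ord1 mxvecE mx_entry_le_norm.
by rewrite -(mxvecE M) mx_entry_le_norm.
Qed.

(** * Injective linear maps on matrices are bounded below *)

Lemma lin_mx_unit (F : fieldType) (m n : nat)
    (f : {linear 'M[F]_(m, n) -> 'M[F]_(m, n)}) :
  (forall X, f X = 0 -> X = 0) -> lin_mx f \in unitmx.
Proof.
move=> f0; rewrite -row_free_unit -kermx_eq0; apply/eqP/row_matrixP => i.
rewrite row0; apply: (can_inj vec_mxK); rewrite linear0; apply: f0.
apply: (can_inj mxvecK); rewrite -mul_vec_lin vec_mxK -row_mul mulmx_ker.
by rewrite row0 linear0.
Qed.

Lemma injective_linear_bounded_below (R : realType) (m n : nat)
    (f : {linear 'M[R]_(m, n) -> 'M[R]_(m, n)}) :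
  (forall X, f X = 0 -> X = 0) ->
  exists2 C : R, 0 < C & forall X, `|X| <= C * `|f X|.
Proof.
move=> f0.
have Uf := lin_mx_unit f0.
(* The summand 1 keeps the constant positive when m n = 0. *)
exists (1 + (m * n)%:R * `|invmx (lin_mx f)|).
  by rewrite ltr_pwDl // mulr_ge0.
move=> X; rewrite -[leLHS]mxvec_norm -[mxvec X](mulmxK Uf) mul_vec_lin.
rewrite (le_trans (mx_norm_mul _ _)) // mxvec_norm mulrDl mul1r.
by rewrite mulrAC mulrA ler_wpDl.
Qed.

Lemma injective_linear_surjective (R : realType) (m n : nat)
    (f : {linear 'M[R]_(m, n) -> 'M[R]_(m, n)}) :
  (forall X, f X = 0 -> X = 0) -> forall Y, exists X, f X = Y.
Proof.
move=> f0 Y.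
have Uf := lin_mx_unit f0.
exists (vec_mx (mxvec Y *m invmx (lin_mx f))).
by apply: (can_inj mxvecK); rewrite -mul_vec_lin vec_mxK mulmxKV.
Qed.

(** * Perturbation of Lyapunov operators *)

Lemma mx_norm_lyapop (R : realType) (n : nat) (F X : 'M[R]_n) :
  `|lyapop F X| <= 2 * n%:R * `|F| * `|X|.
Proof.
rewrite (le_trans (ler_normD _ _)) //.
have := mx_norm_mul X F; have := mx_norm_mul F^T X; rewrite mx_norm_trmx; lra.
Qed.

Lemma lyapopDl (R : realType) (n : nat) (F G X : 'M[R]_n) :
  lyapop (F + G) X = lyapop F X + lyapop G X.
Proof. by rewrite /lyapop mulmxDr linearD mulmxDl addrACA. Qed.

(** The perturbation changes [lyapop F X] by at most 2 n |D| |X|, which costs at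
    most half of |X|.  This makes the Lyapunov equation uniquely solvable near a
    stabilizing gain, and its solution Lipschitz there. *)
Lemma lyapop_perturb (R : realType) (n : nat) (F D : 'M[R]_n) (C : R) :
  (forall X, `|X| <= C * `|lyapop F X|) ->
  0 < C -> 4 * n%:R * C * `|D| <= 1 ->
  forall X, `|X| <= 2 * C * `|lyapop (F + D) X|.
Proof.
move=> FC C0 D1 X; have := FC X.
have -> : lyapop F X = lyapop (F + D) X - lyapop D X by rewrite lyapopDl addrK.
move=> XC; have : `|X| <= C * (`|lyapop (F + D) X| + 2 * n%:R * `|D| * `|X|).
  rewrite (le_trans XC) // (ler_wpM2l (ltW C0)) // (le_trans (ler_normB _ _)) //.
  by rewrite lerD2l mx_norm_lyapop.
have := normr_ge0 X; nra.
Qed.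

(** * Expansion of matrix identities *)

Lemma addmxE (V : nmodType) (m n : nat) (M N : 'M[V]_(m, n)) i j :
  (M + N) i j = M i j + N i j.
Proof. by rewrite mxE. Qed.

Lemma oppmxE (V : zmodType) (m n : nat) (M : 'M[V]_(m, n)) i j :
  (- M) i j = - M i j.
Proof. by rewrite mxE. Qed.

Lemma trmxD (V : nmodType) (m n : nat) (M N : 'M[V]_(m, n)) :
  (M + N)^T = M^T + N^T.
Proof. by apply/matrixP => i j; rewrite !mxE. Qed.

Lemma trmxN (V : zmodType) (m n : nat) (M : 'M[V]_(m, n)) : (- M)^T = - M^T.
Proof. by apply/matrixP => i j; rewrite !mxE. Qed.

(** Matrix products do not commute, so an identity between matrices is first
    expanded into a sum of products, then checked entrywise by the commutative
    ring tactic, for which each product is an atom. *)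
Ltac mx_expand := rewrite ?(trmxD, trmxN, trmx_mul, trmxK, mulmxDl, mulmxDr,
  mulmxN, mulNmx, mulmxA).
Ltac mx_ring := apply/matrixP => ? ?; rewrite ?(addmxE, oppmxE); ring.

(** * The Lyapunov equation of the LQR cost *)

Lemma lyapunovE (R : realType) (n m : nat) (A : 'M[R]_n) (B : 'M[R]_(n, m))
    (Q : 'M[R]_n) (S : 'M[R]_m) (K : 'M[R]_(m, n)) :
  (forall X, lyapop (A - B *m K) X = 0 -> X = 0) ->
  lyapop (A - B *m K) (lyapunov A B Q S K) = - (K^T *m S *m K + Q).
Proof.
move=> inj; have [P PE] := injective_linear_surjective inj (- (K^T *m S *m K + Q)).
have solE X : lyapunov_solution A B Q S K X <->
    lyapop (A - B *m K) X = - (K^T *m S *m K + Q).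
  rewrite /lyapunov_solution /= -addrA -/(lyapop _ X).
  by split=> [/eqP|->]; [rewrite addr_eq0 => /eqP|rewrite addNr].
by apply/solE; apply: (xgetPex 0); exists P; apply/solE.
Qed.

Lemma lyapop_sym (R : realType) (n : nat) (F P W : 'M[R]_n) :
  (forall X, lyapop F X = 0 -> X = 0) -> W^T = W -> lyapop F P = W -> P^T = P.
Proof.
move=> inj WT PW; apply/eqP; rewrite -subr_eq0; apply/eqP/inj.
by rewrite linearB /= lyapop_trmx PW WT subrr.
Qed.

Lemma state_cost_sym (R : realType) (n m : nat)
    (Q : 'M[R]_n) (S : 'M[R]_m) (K : 'M[R]_(m, n)) :
  Q^T = Q -> S^T = S -> (- (K^T *m S *m K + Q))^T = - (K^T *m S *m K + Q).
Proof. by move=> QT ST; rewrite trmxN trmxD !trmx_mul trmxK ST QT mulmxA. Qed.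

(** The gradient of the cost is 2 E Y, where Y is the Gramian.  The cross terms
    produced by B (K + D) involve B^T P = S K - E, and the terms free of E
    complete the square of K + D.  The identity is used twice: for a small D it
    controls the variation of the solution P, and when K + D is a fixed
    stabilizing gain it bounds P by E. *)
Lemma lyapop_other_gain (R : realType) (n m : nat) (A : 'M[R]_n)
    (B : 'M[R]_(n, m)) (Q : 'M[R]_n) (S : 'M[R]_m) (K D : 'M[R]_(m, n))
    (P : 'M[R]_n) (E := S *m K - B^T *m P) :
  S^T = S -> P^T = P -> lyapop (A - B *m K) P = - (K^T *m S *m K + Q) ->
  lyapop (A - B *m (K + D)) P =
    - ((K + D)^T *m S *m (K + D) + Q) + (D^T *m S *m D + E^T *m D + D^T *m E).
Proof.
move=> ST PT PE.
have -> : A - B *m (K + D) = (A - B *m K) + - (B *m D) by mx_expand; mx_ring.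
rewrite lyapopDl PE /E /lyapop; mx_expand; rewrite ST PT; mx_ring.
Qed.

(** * Frobenius norm and Gramian *)

Lemma frobenius_sqr (R : realType) (m n : nat) (M : 'M[R]_(m, n)) :
  frobenius M ^+ 2 = \tr (M *m M^T).
Proof.
rewrite sqr_sqrtr; last first.
  by apply: sumr_ge0 => i _; apply: sumr_ge0 => j _; rewrite sqr_ge0.
by apply: eq_bigr => i _; rewrite mxE; apply: eq_bigr => j _; rewrite mxE expr2.
Qed.

Lemma mx_norm_frobenius (R : realType) (m n : nat) (M : 'M[R]_(m, n)) :
  `|M| <= frobenius M.
Proof.
apply: mx_norm_le => [|i j]; first exact: sqrtr_ge0.
rewrite -sqrtr_sqr ler_wsqrtr // (bigD1 i) //= (bigD1 j) //= -addrA lerDl.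
rewrite addr_ge0 //; first by apply: sumr_ge0 => k _; rewrite sqr_ge0.
by apply: sumr_ge0 => l _; apply: sumr_ge0 => k _; rewrite sqr_ge0.
Qed.

(** Multiplying the Lyapunov equation of Y by E on the left and E^T on the right
    and taking traces gives |E|_F ^ 2 = - 2 tr (E Y F^T E^T), a product of E Y,
    F and E: one factor E cancels. *)
Lemma mx_norm_le_mul_gramian (R : realType) (m n : nat) (F Y : 'M[R]_n)
    (E : 'M[R]_(m, n)) :
  Y^T = Y -> lyapop F^T Y = - 1%:M ->
  `|E| <= 2 * m%:R * n%:R * n%:R * `|F| * `|E *m Y|.
Proof.
move=> YT YE.
have [->|E0] := eqVneq `|E| 0; first by rewrite !mulr_ge0.
have {}E0 : 0 < `|E| by rewrite lt_neqAle eq_sym E0 normr_ge0.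
have fE : frobenius E ^+ 2 = - 2 * \tr (E *m Y *m F^T *m E^T).
  have -> : frobenius E ^+ 2 = - \tr (E *m lyapop F^T Y *m E^T).
    by rewrite YE mulmxN mulmx1 mulNmx linearN /= opprK frobenius_sqr.
  rewrite /lyapop trmxK mulmxDr mulmxDl linearD /= !mulmxA.
  rewrite -[\tr (E *m F *m Y *m E^T)]mxtrace_tr !trmx_mul trmxK YT !mulmxA; ring.
have : `|E| ^+ 2 <= frobenius E ^+ 2.
  by rewrite lerXn2r ?nnegrE ?mx_norm_frobenius// (le_trans _ (mx_norm_frobenius E)).
rewrite fE => Esq.
have := mx_norm_trace (E *m Y *m F^T *m E^T).
rewrite ler_norml => /andP[lo _].
have : `|E *m Y *m F^T *m E^T| <= n%:R * (n%:R * (`|E *m Y| * `|F|) * `|E|).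
  by rewrite mx_norm_mul_le // ?mx_norm_trmx // -(mx_norm_trmx F) mx_norm_mul.
move=> /(ler_wpM2l (ler0n R m)) hi.
rewrite -(ler_pM2r E0) -expr2 (le_trans Esq) //; lra.
Qed.

(** * Blow-up of Lyapunov solutions at the boundary *)

(** Real form of the equation F v = i w v, with v = x + i y. *)
Lemma imaginary_eigenplane (R : realType) (n : nat) (F : 'M[R]_n) :
  re_spectrum F 0 -> exists w : R, exists x y : 'cV[R]_n,
    [/\ (x != 0) || (y != 0), F *m x = - (w *: y) & F *m y = w *: x].
Proof.
move=> [[z1 z2] /= zF z0]; rewrite {}z0 in zF.
(* [eigenvalue] speaks of row vectors: column eigenvectors of F come from F^T. *)
move: zF; rewrite -eigenvalue_trmx => /eigenvalueP[v vF v0].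
have vj j : (\sum_k v 0 k * (F j k)%:C)%C = ((0 +i* z2) * v 0 j)%C.
  move/matrixP : vF => /(_ 0 j); rewrite !mxE => <-.
  by apply: eq_bigr => k _; rewrite !mxE.
exists z2, (\col_i complex.Re (v 0 i)), (\col_i complex.Im (v 0 i)); split.
- rewrite -negb_and; apply: contra v0 => /andP[/eqP x0 /eqP y0].
  apply/eqP/rowP => j; rewrite mxE.
  move/colP : x0 => /(_ j); move/colP : y0 => /(_ j); rewrite !mxE.
  by case: (v 0 j) => a b /= -> ->.
- apply/colP => j; rewrite !mxE.
  have := congr1 (@complex.Re R) (vj j); rewrite raddf_sum /=.
  case: (v 0 j) => a b /=; rewrite mul0r sub0r => <-.
  by apply: eq_bigr => k _; rewrite mxE; case: (v 0 k) => c d /=; ring.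
- apply/colP => j; rewrite !mxE.
  have := congr1 (@complex.Im R) (vj j); rewrite raddf_sum /=.
  case: (v 0 j) => a b /=; rewrite mul0r add0r => <-.
  by apply: eq_bigr => k _; rewrite mxE; case: (v 0 k) => c d /=; ring.
Qed.

Lemma scalemxE (R : pzSemiRingType) (m n : nat) (a : R) (M : 'M[R]_(m, n)) i j :
  (a *: M) i j = a * M i j.
Proof. by rewrite mxE. Qed.

Lemma mx11_tr (R : comNzRingType) (M : 'M[R]_1) : M^T 0 0 = M 0 0.
Proof. by rewrite mxE. Qed.

(** Evaluate the Lyapunov equation on the vectors x and y of
    [imaginary_eigenplane].  By symmetry of P the contributions of A - B Kbar at
    x and at y cancel, so what is left on the side of P is linear in K - Kbar,
    while the other side is at least x^T Q x + y^T Q y > 0 in absolute value. *)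
Lemma lyapop_blowup (R : realType) (n m : nat) (A : 'M[R]_n)
    (B : 'M[R]_(n, m)) (Q : 'M[R]_n) (S : 'M[R]_m) (Kbar : 'M[R]_(m, n)) :
  posdefmx Q -> posdefmx S -> re_spectrum (A - B *m Kbar) 0 ->
  exists2 c : R, 0 < c & forall K P, P^T = P ->
    lyapop (A - B *m K) P = - (K^T *m S *m K + Q) -> c <= `|K - Kbar| * `|P|.
Proof.
move=> [QT Qpos] [ST Spos] /imaginary_eigenplane[w [x [y [xy0 Fx Fy]]]].
have Spsd (u : 'cV[R]_m) : 0 <= (u^T *m S *m u) 0 0.
  have [->|u0] := eqVneq u 0; first by rewrite mulmx0 mxE.
  exact: ltW (Spos u u0).
have Qpsd (u : 'cV[R]_n) : 0 <= (u^T *m Q *m u) 0 0.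
  have [->|u0] := eqVneq u 0; first by rewrite mulmx0 mxE.
  exact: ltW (Qpos u u0).
set q := (x^T *m Q *m x) 0 0 + (y^T *m Q *m y) 0 0.
have q0 : 0 < q.
  by case/orP : xy0 => /Qpos u0; [rewrite ltr_wpDr|rewrite ltr_wpDl].
(* b u collects the dimensions and norms in the bound on u^T P B (K - Kbar) u. *)
pose b (u : 'cV[R]_n) := n%:R * (`|u| * (n%:R * (n%:R * (m%:R * `|B| * `|u|)))).
have b0 u : 0 <= b u by rewrite !mulr_ge0.
have bE u (G : 'M[R]_(m, n)) (P : 'M[R]_n) :
    `|(u^T *m (P *m ((B *m G) *m u))) 0 0| <= b u * (`|G| * `|P|).
  rewrite (le_trans (mx_entry_le_norm _ _ _)) //.
  rewrite (le_trans (mx_norm_mul_le (lexx _) (mx_norm_mul_le (lexx _)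
    (mx_norm_mul_le (mx_norm_mul _ _) (lexx _))))) // mx_norm_trmx /b.
  by rewrite le_eqVlt; apply/orP; left; apply/eqP; ring.
exists (q / (2 * (b x + b y) + 1)).
  by rewrite divr_gt0 // ltr_wpDl // mulr_ge0 // addr_ge0.
move=> K P PT PE; set G := K - Kbar.
(* The weight K^T S K only helps, being positive semidefinite. *)
have quad (u : 'cV[R]_n) : (u^T *m Q *m u) 0 0 <=
    - 2 * (u^T *m P *m ((A - B *m Kbar) *m u)) 0 0 + 2 * (u^T *m (P *m ((B *m G) *m u))) 0 0.
  have := Spsd (K *m u).
  have := congr1 (fun M : 'M[R]_n => (u^T *m M *m u) 0 0) PE.
  have -> : A - B *m K = (A - B *m Kbar) + - (B *m G).
    by rewrite /G; mx_expand; mx_ring.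
  rewrite lyapopDl /lyapop.
  set Fb := A - B *m Kbar; set BG := B *m G.
  have -> : u^T *m (P *m Fb + Fb^T *m P + (P *m - BG + (- BG)^T *m P)) *m u =
    u^T *m P *m Fb *m u + (u^T *m P *m Fb *m u)^T
    - (u^T *m P *m BG *m u) - (u^T *m P *m BG *m u)^T.
    by mx_expand; rewrite PT; mx_ring.
  have -> : u^T *m (- (K^T *m S *m K + Q)) *m u =
    - (u^T *m K^T *m S *m K *m u) - (u^T *m Q *m u).
    by mx_expand; mx_ring.
  rewrite ?(addmxE, oppmxE) !mx11_tr trmx_mul !mulmxA; lra.
have cross : (x^T *m P *m ((A - B *m Kbar) *m x)) 0 0 +
             (y^T *m P *m ((A - B *m Kbar) *m y)) 0 0 = 0.
  rewrite Fx Fy mulmxN -!scalemxAr oppmxE !scalemxE.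
  by rewrite -(mx11_tr (y^T *m P *m x)) !trmx_mul trmxK PT mulmxA; ring.
have := quad x; have := quad y.
have := bE x G P; have := bE y G P; rewrite !ler_norml => /andP[_ ?] /andP[_ ?].
have GP : 0 <= `|G| * `|P| by rewrite mulr_ge0.
move=> qy qx; rewrite ler_pdivrMr; last by rewrite ltr_wpDl // mulr_ge0 // addr_ge0.
rewrite /q mulrDr mulr1 mulrCA mulrDr; lra.
Qed.

(** * The gradient of the LQR cost *)

Definition trace_pairing (R : realType) (m n : nat) (G H : 'M[R]_(m, n)) : R :=
  \tr (G^T *m H).

Lemma trace_pairing_is_linear (R : realType) (m n : nat) (G : 'M[R]_(m, n)) :
  linear (trace_pairing G : 'M[R]_(m, n) -> R^o).
Proof.
by move=> a X Y; rewrite /trace_pairing mulmxDr -scalemxAr linearD linearZ.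
Qed.

HB.instance Definition _ (R : realType) (m n : nat) (G : 'M[R]_(m, n)) :=
  GRing.isLinear.Build R 'M[R]_(m, n) R^o *:%R (trace_pairing G)
    (trace_pairing_is_linear G).

(** The adjoint of the Lyapunov operator of F is that of F^T, and Y is chosen so
    that the latter sends it to minus the identity, which represents - tr. *)
Lemma mxtrace_lyapop (R : realType) (n : nat) (F Y X : 'M[R]_n) :
  lyapop F^T Y = - 1%:M -> \tr X = - \tr (lyapop F X *m Y).
Proof.
move=> YE; rewrite -[X in LHS]mulmx1 -[1%:M]opprK -YE mulmxN linearN /=.
rewrite /lyapop trmxK mulmxDr mulmxDl !linearD /= !mulmxA addrC.
by rewrite -(mulmxA F^T) (mxtrace_mulC F^T).
Qed.

(** Let D be the variation of the Lyapunov solution.  By [mxtrace_lyapop],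
    tr D = - tr (lyapop F D Y), and [lyapop F D] is known up to terms of order
    |D| |H| and |H| ^ 2.  The lower bound on the perturbed operator gives
    |D| = O(|H|), so these terms are quadratic in H and the linear part is
    2 tr (E^T H Y). *)
Lemma lqr_cost_taylor (R : realType) (n m : nat) (A : 'M[R]_n)
    (B : 'M[R]_(n, m)) (Q : 'M[R]_n) (S : 'M[R]_m) (K : 'M[R]_(m, n))
    (Y : 'M[R]_n) (E := S *m K - B^T *m lyapunov A B Q S K) :
  Q^T = Q -> S^T = S -> Hurwitz (A - B *m K) ->
  Y^T = Y -> lyapop (A - B *m K)^T Y = - 1%:M ->
  exists M r : R, [/\ 0 <= M, 0 < r & forall H, `|H| <= r ->
    `|lqr_cost A B Q S (K + H) - lqr_cost A B Q S K - trace_pairing (2 *: (E *m Y)) H|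
      <= M * `|H| ^+ 2].
Proof.
move=> QT ST HF YT YE; set F := A - B *m K in HF YE.
have inj X := @lyapop_eq0 _ _ F X HF.
have [C C0 FC] := injective_linear_bounded_below inj.
have C0' := ltW C0.
have PE := @lyapunovE _ _ _ A B Q S K inj.
have PT := lyapop_sym inj (state_cost_sym K QT ST) PE.
set P := lyapunov A B Q S K in PE PT E *.
pose a := 2 * C * (m%:R * m%:R * `|S| + 2 * m%:R * `|E|).
have a0 : 0 <= a by rewrite !(mulr_ge0, addr_ge0) //.
pose k := 4 * n%:R * C * m%:R * `|B|.
have k0 : 0 <= k by rewrite !mulr_ge0 //.
(* On the ball of radius 1 / (1 + k) both |H| <= 1 and the smallness condition
   of [lyapop_perturb] for B H hold. *)
exists (n%:R * (n%:R * m%:R * m%:R * `|S| * `|Y| +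
  2 * n%:R * n%:R * a * m%:R * `|B| * `|Y|)), (1 + k)^-1; split.
- by rewrite !(mulr_ge0, addr_ge0).
- by rewrite invr_gt0 ltr_pwDl.
move=> H; rewrite -[(1 + k)^-1]mul1r ler_pdivlMr ?ltr_pwDl // => Hr.
have [H1 Hk] : `|H| <= 1 /\ k * `|H| <= 1.
  by have := mulr_ge0 k0 (normr_ge0 H); have := normr_ge0 H; split; lra.
have BH : `| - (B *m H)| <= m%:R * (`|B| * `|H|) by rewrite normrN mx_norm_mul.
have F'C X : `|X| <= 2 * C * `|lyapop (A - B *m (K + H)) X|.
  have -> : A - B *m (K + H) = F + - (B *m H) by rewrite /F; mx_expand; mx_ring.
  apply: lyapop_perturb => //; apply: le_trans Hk.
  have c0 : 0 <= 4 * n%:R * C by rewrite !mulr_ge0 //.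
  by apply: (le_trans (ler_wpM2l c0 BH)); rewrite /k !mulrA.
have inj' X : lyapop (A - B *m (K + H)) X = 0 -> X = 0.
  by move=> X0; have := F'C X; rewrite X0 normr0 mulr0 normr_le0 => /eqP.
have P'E := @lyapunovE _ _ _ A B Q S (K + H) inj'.
rewrite /lqr_cost /trace_pairing -/P; set P' := lyapunov A B Q S (K + H) in P'E *.
set D := P' - P.
have DE' : lyapop (A - B *m (K + H)) D =
    - (H^T *m S *m H + E^T *m H + H^T *m E).
  by rewrite /D linearB /= P'E (lyapop_other_gain H ST PT PE) -/E; mx_ring.
have DE : lyapop F D = lyapop (A - B *m (K + H)) D
    + (D *m (B *m H) + (B *m H)^T *m D).
  have -> : A - B *m (K + H) = F + - (B *m H) by rewrite /F; mx_expand; mx_ring.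
  by rewrite lyapopDl /lyapop; mx_expand; mx_ring.
have Da : `|D| <= a * `|H|.
  rewrite (le_trans (F'C D)) // DE' normrN.
  have t1 : `|H^T *m S *m H| <= m%:R * (m%:R * (`|H| * `|S|) * `|H|).
    by rewrite mx_norm_mul_le // -(mx_norm_trmx H) mx_norm_mul.
  have t2 : `|E^T *m H| <= m%:R * (`|E| * `|H|).
    by rewrite -(mx_norm_trmx E) mx_norm_mul.
  have t3 : `|H^T *m E| <= m%:R * (`|E| * `|H|).
    by rewrite (mulrC `|E|) -(mx_norm_trmx H) mx_norm_mul.
  have t4 : m%:R * (m%:R * (`|H| * `|S|) * `|H|) <= m%:R * m%:R * `|S| * `|H|.
    have -> : m%:R * (m%:R * (`|H| * `|S|) * `|H|) =
        m%:R * m%:R * `|S| * `|H| * `|H| :> R by ring.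
    by rewrite ler_piMr // !mulr_ge0.
  have := ler_normD (H^T *m S *m H + E^T *m H) (H^T *m E).
  have := ler_normD (H^T *m S *m H) (E^T *m H).
  move=> s1 s2.
  have c0 : 0 <= 2 * C by rewrite mulr_ge0 //.
  rewrite /a -[leRHS]mulrA ler_wpM2l //; lra.
have trE : \tr P' - \tr P - \tr ((2 *: (E *m Y))^T *m H) =
    \tr (H^T *m S *m H *m Y - D *m (B *m H) *m Y - (B *m H)^T *m D *m Y).
  rewrite -linearB /= -/D (mxtrace_lyapop D YE) DE DE'.
  have -> : (- (H^T *m S *m H + E^T *m H + H^T *m E)
      + (D *m (B *m H) + (B *m H)^T *m D)) *m Y =
    - (E^T *m H *m Y + H^T *m E *m Y) - (H^T *m S *m H *m Y - D *m (B *m H) *m Y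
      - (B *m H)^T *m D *m Y) by mx_expand; mx_ring.
  set rem := (X in _ = \tr X).
  rewrite linearB linearN /= mxtraceD -/rem -(mxtrace_tr (H^T *m E *m Y)).
  rewrite !trmx_mul trmxK YT linearZ /= trmx_mul YT.
  rewrite -!scalemxAl linearZ /= (mxtrace_mulC (E^T *m H)) !mulmxA; ring.
rewrite trE (le_trans (mx_norm_trace _)) // -[leRHS]mulrA ler_wpM2l //.
have u1 : `|H^T *m S *m H *m Y| <= n%:R * (m%:R * (m%:R * (`|H| * `|S|) * `|H|) * `|Y|).
  by rewrite !mx_norm_mul_le // mx_norm_trmx.
have u2 : `|D *m (B *m H) *m Y| <=
    n%:R * (n%:R * (a * `|H| * (m%:R * (`|B| * `|H|))) * `|Y|).
  by rewrite !mx_norm_mul_le.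
have u3 : `|(B *m H)^T *m D *m Y| <=
    n%:R * (n%:R * (m%:R * (`|B| * `|H|) * (a * `|H|)) * `|Y|).
  by rewrite !mx_norm_mul_le // mx_norm_trmx mx_norm_mul.
have := ler_normB (H^T *m S *m H *m Y - D *m (B *m H) *m Y) ((B *m H)^T *m D *m Y).
have := ler_normB (H^T *m S *m H *m Y) (D *m (B *m H) *m Y).
lra.
Qed.

Lemma gradient_of_taylor (R : realType) (m n : nat) (f : 'M[R]_(m, n) -> R)
    (K G : 'M[R]_(m, n)) (M r : R) :
  0 <= M -> 0 < r ->
  (forall H, `|H| <= r ->
     `|f (K + H) - f K - trace_pairing G H| <= M * `|H| ^+ 2) ->
  gradient f K = G.
Proof.
move=> M0 r0 fK.
have cG : continuous (trace_pairing G : 'M[R]_(m, n) -> R^o).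
  apply/linear_bounded_continuous/linear_boundedP.
  have := nbhs_pinfty_ge (num_real (n%:R * (m%:R * `|G|))).
  apply: filterS => c Gc H; apply: (le_trans (mx_norm_trace _)).
  rewrite (le_trans (ler_wpM2l _ (mx_norm_mul _ _))) // mx_norm_trmx.
  by rewrite !mulrA ler_wpM2r // -mulrA.
have dE : 'd (f : 'M[R]_(m, n) -> R^o) K = trace_pairing G :> ('M[R]_(m, n) -> R^o).
  apply: diff_unique => //; apply/eqaddoP => e e0.
  have r1 : 0 < Num.min r (e / (M + 1)).
    by rewrite lt_min r0 divr_gt0 // ltr_wpDl.
  have := @nbhs0_le _ 'M[R]_(m, n) _ r1.
  apply: filterS => H; rewrite le_min => /andP[Hr].
  rewrite ler_pdivlMr ?ltr_wpDl // => He.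
  have := fK H Hr; rewrite /= !fctE /= opprD addrA (addrC H) => /le_trans -> //.
  rewrite expr2 mulrA ler_wpM2r //.
  by apply: le_trans He; rewrite mulrC ler_wpM2l // lerDl.
apply/matrixP => i j; rewrite mxE.
have -> : 'd f K (delta_mx i j) = trace_pairing G (delta_mx i j) by rewrite -dE.
rewrite /trace_pairing /mxtrace (bigD1 j) //= big1 => [|k kj].
  rewrite addr0 mxE (bigD1 i) //= big1 => [|l li]; last by rewrite !mxE (negPf li) mulr0.
  by rewrite !mxE !eqxx mulr1 addr0.
by rewrite mxE big1 // => l _; rewrite !mxE (negPf kj) andbF mulr0.
Qed.

(** * Divergence of the gradient *)

(** The operator inverted here is that of the fixed gain K0, so its bound does
    not degrade as K approaches the boundary: P is bounded by its image, which
    is affine in E ([lyapop_other_gain]), and E is bounded by the gradient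
    2 E Y ([mx_norm_le_mul_gramian]). *)
Lemma lyapunov_le_gradient (R : realType) (n m : nat) (A : 'M[R]_n)
    (B : 'M[R]_(n, m)) (Q : 'M[R]_n) (S : 'M[R]_m) (K0 : 'M[R]_(m, n)) (r : R) :
  Q^T = Q -> S^T = S -> stabilizing A B K0 -> 0 <= r ->
  exists a b : R, [/\ 0 <= a, 0 <= b & forall K, stabilizing A B K -> `|K| <= r ->
    `|lyapunov A B Q S K| <= a + b * frobenius (gradient (lqr_cost A B Q S) K)].
Proof.
move=> QT ST HF0 r0.
have [C C0 F0C] := injective_linear_bounded_below (fun X => @lyapop_eq0 _ _ _ X HF0).
have C0' := ltW C0.
pose d := `|K0| + r; have d0 : 0 <= d by rewrite addr_ge0.
pose phi := `|A| + m%:R * (`|B| * r).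
have phi0 : 0 <= phi by rewrite !(addr_ge0, mulr_ge0).
pose e := 2 * m%:R * n%:R * n%:R * phi.
have e0 : 0 <= e by rewrite !mulr_ge0.
pose W := K0^T *m S *m K0 + Q.
exists (C * (`|W| + m%:R * (m%:R * (d * `|S|) * d))), (C * (2 * m%:R * d * e)).
split; [by rewrite !(mulr_ge0, addr_ge0)|by rewrite !mulr_ge0|].
move=> K HF Kr.
have inj X := @lyapop_eq0 _ _ _ X HF.
have PE := @lyapunovE _ _ _ A B Q S K inj.
have PT := lyapop_sym inj (state_cost_sym K QT ST) PE.
have injT X := @lyapop_eq0 _ _ _ X (Hurwitz_trmx HF).
have [Y YE] := injective_linear_surjective injT (- 1%:M).
have I_sym : (- 1%:M : 'M[R]_n)^T = - 1%:M by rewrite trmxN trmx1.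
have YT := lyapop_sym injT I_sym YE.
have [M [rho [M0 rho0 taylor]]] := lqr_cost_taylor QT ST HF YT YE.
rewrite (gradient_of_taylor M0 rho0 taylor) {taylor}.
have := lyapop_other_gain (K0 - K) ST PT PE.
set P := lyapunov A B Q S K; set E := S *m K - B^T *m P; set D := K0 - K.
rewrite addrCA subrr addr0 -/W => P0.
have Dd : `|D| <= d by rewrite (le_trans (ler_normB _ _)) // lerD2l.
have Fphi : `|A - B *m K| <= phi.
  rewrite (le_trans (ler_normB _ _)) // lerD2l (le_trans (mx_norm_mul _ _)) //.
  by rewrite !ler_wpM2l.
set g := frobenius _.
have Eg : `|E| <= e * g.
  rewrite (le_trans (mx_norm_le_mul_gramian E YT YE)) // /e.
  have EYg : `|E *m Y| <= g.
    rewrite (le_trans _ (mx_norm_frobenius _)) // normrZ ger0_norm //.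
    by rewrite ler_peMl // ler1n.
  by rewrite ler_pM ?mulr_ge0 // ler_wpM2l // !mulr_ge0.
have t1 : `|D^T *m S *m D| <= m%:R * (m%:R * (d * `|S|) * d).
  by rewrite !mx_norm_mul_le // mx_norm_trmx.
have t2 : `|E^T *m D| <= m%:R * (e * g * d).
  by rewrite mx_norm_mul_le // mx_norm_trmx.
have t3 : `|D^T *m E| <= m%:R * (d * (e * g)).
  by rewrite mx_norm_mul_le // mx_norm_trmx.
rewrite (le_trans (F0C P)) //= P0 -(mulrA C) -mulrDr ler_wpM2l //.
have := ler_normD (- W) (D^T *m S *m D + E^T *m D + D^T *m E).
have := ler_normD (D^T *m S *m D + E^T *m D) (D^T *m E).
have := ler_normD (D^T *m S *m D) (E^T *m D).
rewrite normrN; lra.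
Qed.

Unset Implicit Arguments.

Theorem lemma9 (R : realType) (n m : nat)
    (A : 'M[R]_n) (B : 'M[R]_(n, m)) (Q : 'M[R]_n) (S : 'M[R]_m)
    (AB_controllable : controllable A B)
    (Q_posdef : posdefmx Q) (S_posdef : posdefmx S)
    (Kbar : 'M[R]_(m, n)) (Kbar_boundary : stabilizing_boundary A B Kbar)
    (K : nat -> 'M[R]_(m, n)) (K_stabilizing : forall i, stabilizing A B (K i))
    (K_cvg : K i @[i --> \oo] --> Kbar) :
  frobenius (gradient (lqr_cost A B Q S) (K i)) @[i --> \oo] --> +oo.
Proof.
have [QT _] := Q_posdef; have [ST _] := S_posdef.
have [c c0 blowup] := lyapop_blowup Q_posdef S_posdef (proj1 Kbar_boundary).
have r0 : 0 <= `|Kbar| + 1 by rewrite addr_ge0.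
have [a [b [a0 b0 Pab]]] :=
  lyapunov_le_gradient QT ST (K_stabilizing 0%N) r0.
apply/cvgryPge => t.
have d0 : 0 < Num.min 1 (c / (a + b * `|t| + 1)).
  by rewrite lt_min ltr01 divr_gt0 // ltr_wpDl // addr_ge0 // mulr_ge0.
move/cvgrPdist_lt : K_cvg => /(_ _ d0); apply: filterS => i.
rewrite distrC lt_min => /andP[Ki1]; rewrite ltr_pdivlMr; last first.
  by rewrite ltr_wpDl // addr_ge0 // mulr_ge0.
(* If the gradient were below t, then P would be at most a + b |t|, and the
   product in [lyapop_blowup] would fall below c. *)
move=> Kic; rewrite leNgt; apply/negP => gt.
have Kir : `|K i| <= `|Kbar| + 1.
  by rewrite -[K i](subrK Kbar) addrC (le_trans (ler_normD _ _)) // lerD2l ltW.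
have inj X := @lyapop_eq0 _ _ _ X (K_stabilizing i).
have PE := @lyapunovE _ _ _ A B Q S (K i) inj.
have PT := lyapop_sym inj (state_cost_sym (K i) QT ST) PE.
have := blowup _ _ PT PE; rewrite leNgt => /negP; apply.
apply: le_lt_trans Kic; rewrite ler_wpM2l // (le_trans (Pab _ _ Kir)) //.
rewrite -addrA lerD2l ler_wpDr // ler_wpM2l // (le_trans (ltW gt)) //.
exact: ler_norm.
Qed.
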